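(* There is a function $q\colon \mathbb{N}^2 \to \mathbb{N}$ such that, for every $c,d,k\in \mathbb{N}$, the following hold. (i) Every finite graph that has a $(k,d)$-centred path-decomposition is $q(k,d)$-quasi-isometric to a finite graph with pathwidth at most $2k-1$. (ii) Every finite graph that is $c$-quasi-isometric to a finite graph with pathwidth at most $k$ has a $(k+1,3c^2)$-centred path-decomposition.
   Context: $\mathbb{N}$ is the set of positive integers. Graphs are simple, undirected, unweighted and finite (not necessarily connected). $\operatorname{dist}_G(u,v)$ is the length of a shortest path between $u$ and $v$ in $G$, and is $\infty$ if no such path exists. Quasi-isometry: for $q\in\mathbb{N}$, a $q$-quasi-isometry of $G$ into $H$ is a map $\phi\colon V(G)\to V(H)$ such that $q^{-1}\operatorname{dist}_G(u,v)-q\le \operatorname{dist}_H(\phi(u),\phi(v))\le q\operatorname{dist}_G(u,v)+q$ for all $u,v\in V(G)$, and for every $x\in V(H)$ there is $v\in V(G)$ with $\operatorname{dist}_H(x,\phi(v))\le q$. If such a map exists, $G$ is $q$-quasi-isometric to $H$. Decompositions: for a path $P$, a $P$-decomposition of $G$ is a pair $(P,\beta)$ with $\beta\colon V(P)\to 2^{V(G)}$ such that for every edge $uv\in E(G)$ some node $x\in V(P)$ has $u,v\in\beta(x)$, and for every $v\in V(G)$ the set $\{x\in V(P): v\in\beta(x)\}$ induces a non-empty connected subpath of $P$. The sets $\beta(x)$ are the bags. The width of $(P,\beta)$ is $\max_x|\beta(x)|-1$. A path-decomposition is a $P$-decomposition for some path $P$. The pathwidth of $G$ is the minimum width of a path-decomposition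 of $G$. Centred sets: the weak diameter of $X\subseteq V(G)$ is the maximum of $\operatorname{dist}_G(u,v)$ over $u,v\in X$ (distances measured in $G$). A set $S\subseteq V(G)$ is $(k,d)$-centred if $S$ has a partition into at most $k$ sets, each of weak diameter at most $d$. A path-decomposition of $G$ is $(k,d)$-centred if each of its bags is $(k,d)$-centred. *)

(* Defs.v *)
From mathcomp Require Import all_boot all_order all_algebra.
From mathcomp Require Import boolp constructive_ereal.

Set Implicit Arguments.
Unset Strict Implicit.
Unset Printing Implicit Defensive.

Import Order.TTheory GRing.Theory Num.Theory.
Local Open Scope ring_scope.

Record sgraph := SGraph {
  vert :> finType;
  adj : rel vert;
  adj_sym : symmetric adj;
  adj_irrefl : irreflexive adj }.

Section Distance.
Variable G : sgraph.
Implicit Types (u v : G) (X S : {set G}).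

Definition has_path u v (n : nat) : bool :=
  [exists p : n.-tuple G,
    [&& path (@adj G) u p, uniq (u :: p) & last u p == v]].

(* A path of G has at most #|G| vertices, hence fewer than #|G| edges; the
   minimum of the empty family is +oo.  Rational values make room for the
   factor q^-1 in the definition of quasi-isometries. *)
Definition dist u v : \bar rat :=
  \big[Order.min/+oo%E]_(n < #|{: G}| | has_path u v n) (n%:R)%:E.

(* Distances are nonnegative, so the default value 0 only matters for the
   empty set. *)
Definition weak_diameter X : \bar rat :=
  \big[Order.max/0%E]_(u in X) \big[Order.max/0%E]_(v in X) dist u v.

Definition centred (k d : nat) S : Prop :=
  exists P : {set {set G}},
    [/\ partition P S, (#|P| <= k)%N &
        forall X, X \in P -> (weak_diameter X <= (d%:R)%:E)%E].

End Distance.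

Definition quasi_isometry (q : nat) (G H : sgraph) (phi : G -> H) : Prop :=
  (forall u v : G,
     (((q%:R : rat)^-1)%:E * dist u v - (q%:R)%:E <= dist (phi u) (phi v))%E /\
     (dist (phi u) (phi v) <= (q%:R)%:E * dist u v + (q%:R)%:E)%E) /\
  (forall x : H, exists v : G, (dist x (phi v) <= (q%:R)%:E)%E).

Definition quasi_isometric (q : nat) (G H : sgraph) : Prop :=
  exists phi : G -> H, quasi_isometry q phi.

Definition path_rel (n : nat) : rel 'I_n :=
  fun i j => (i.+1 == j :> nat) || (j.+1 == i :> nat).

Lemma path_rel_sym n : symmetric (@path_rel n).
Proof. by move=> i j; rewrite /path_rel orbC. Qed.

Lemma path_rel_irrefl n : irreflexive (@path_rel n).
Proof. by move=> i; rewrite /path_rel orbb gtn_eqF. Qed.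

(* The path with n edges, hence n.+1 nodes: paths are nonempty. *)
Definition path_graph (n : nat) : sgraph :=
  SGraph (@path_rel_sym n.+1) (@path_rel_irrefl n.+1).

Definition induces_connected (P : sgraph) (X : {set P}) : Prop :=
  {in X &, forall x y,
     connect [rel a b | [&& a \in X, b \in X & adj a b]] x y}.

Definition decomposition (G P : sgraph) (beta : P -> {set G}) : Prop :=
  (forall u v : G, adj u v -> exists x : P, u \in beta x /\ v \in beta x) /\
  (forall v : G, let X := [set x | v \in beta x] in
     X != set0 /\ induces_connected X).

Definition path_decomposition (G : sgraph) (n : nat)
  (beta : path_graph n -> {set G}) : Prop := decomposition beta.

(* The width is an integer: it is -1 when G has no vertex. *)
Definition width (G : sgraph) (n : nat) (beta : path_graph n -> {set G}) :
  int := (\max_x #|beta x|)%:Z - 1.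

Definition has_width (G : sgraph) (m : nat) : bool :=
  `[< exists n, exists2 beta : path_graph n -> {set G},
        path_decomposition beta & width beta = m%:Z - 1 >].

Lemma has_width_ex (G : sgraph) : exists m, has_width G m.
Proof.
pose beta (_ : path_graph 0) : {set G} := setT.
exists (\max_x #|beta x|)%N; apply/asboolP; exists 0%N, beta => //.
split=> [u v _|v X]; first by exists ord0; rewrite !inE.
split; first by apply/set0Pn; exists ord0; rewrite !inE.
by move=> x y _ _; rewrite (ord1 x) (ord1 y) connect0.
Qed.

(* The minimum width of a path-decomposition.  Widths are at least -1 and
   ex_minn ranges over nat, whence the shift by 1. *)
Definition pathwidth (G : sgraph) : int := (ex_minn (has_width_ex G))%:Z - 1.

Definition has_centred_path_decomposition (k d : nat) (G : sgraph) : Prop :=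
  exists n, exists2 beta : path_graph n -> {set G},
    path_decomposition beta & forall x, centred k d (beta x).

(* Main.v *)
Require Import Defs.
From mathcomp Require Import all_boot all_order all_algebra.
From mathcomp Require Import boolp constructive_ereal.
From mathcomp Require Import zify.

(* (ii) Pull the bags back: take the vertices mapped within distance c of a bag.

   (i) Turn every part of every bag into a clique; distances in G change by a
   factor at most d.  The resulting graph has a 2-colouring whose monochromatic
   components have bounded diameter.  Contracting these components is the
   desired quasi-isometry: a clique meets at most one component of each colour,
   so a bag, being covered by k cliques, meets at most 2k components.

   The 2-colouring is found by induction on k.  Let R be the bound for k - 1 and
   s = R + 2.  Going from left to right, make a bag a breakpoint when its
   distance to the last breakpoint exceeds 3s.  Colour red the vertices within
   distance s of a breakpoint, and blue the remaining ones within distance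
   3s + 1 of the last breakpoint.  Since breakpoint bags separate, the
   s-components of either colour stay near one bag, hence are bounded.  Every
   bag is near the last breakpoint, so one of its k cliques is now coloured
   entirely, and induction colours the rest.  Components of the rest have
   diameter at most R = s - 2, too small to link distinct s-components. *)

Set Implicit Arguments.
Unset Strict Implicit.
Unset Printing Implicit Defensive.

Import Order.TTheory GRing.Theory Num.Theory.
Local Open Scope nat_scope.

(** * Walks and linear families of bags *)

(* [walk e n u v]: some walk of length at most [n] joins [u] to [v]. *)
Inductive walk (V : Type) (e : V -> V -> Prop) : nat -> V -> V -> Prop :=
| walk_refl n u : walk e n u u
| walk_step n u w v : e u w -> walk e n w v -> walk e n.+1 u v.

Section Walks.
Variables (V : Type) (e : V -> V -> Prop).
Implicit Types u v w : V.

Lemma walk1 u v : e u v -> walk e 1 u v.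
Proof. by move=> euv; apply: (walk_step euv); apply: walk_refl. Qed.

Lemma walk_le m n u v : m <= n -> walk e m u v -> walk e n u v.
Proof.
move=> le_mn W; elim: W n le_mn => [k w n _|k w x y ewx _ IH [//|n] le_kn].
  exact: walk_refl.
exact: walk_step ewx (IH _ le_kn).
Qed.

Lemma walk_cat m n u v w :
  walk e m u w -> walk e n w v -> walk e (m + n) u v.
Proof.
move=> W1 W2; elim: W1 W2 => [k x W2|k x y z exy _ IH W2].
  exact: walk_le (leq_addl _ _) W2.
by rewrite addSn; apply: walk_step exy (IH W2).
Qed.

Lemma walk_split m n u v :
  walk e (m + n) u v -> exists w, walk e m u w /\ walk e n w v.
Proof.
elim: m u => [|m IH] u; first by exists u; split=> //; apply: walk_refl.
rewrite addSn => W; inversion W as [k x|k x w y euw Wwv]; subst.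
  by exists v; split; apply: walk_refl.
by have [x [Wx Wy]] := IH _ Wwv; exists x; split=> //; apply: walk_step euw Wx.
Qed.

Lemma walk_sym n u v :
  (forall x y, e x y -> e y x) -> walk e n u v -> walk e n v u.
Proof.
move=> esym; elim=> [k w|k x y z exy _ IH]; first exact: walk_refl.
by rewrite -addn1; apply: walk_cat IH (walk1 (esym _ _ exy)).
Qed.

End Walks.

Lemma walk_map (V W : Type) (e : V -> V -> Prop) (e' : W -> W -> Prop)
    (f : V -> W) (d n : nat) (u v : V) :
    (forall x y, e x y -> walk e' d (f x) (f y)) ->
  walk e n u v -> walk e' (n * d) (f u) (f v).
Proof.
move=> h; elim=> [k w|k x y z exy _ IH]; first exact: walk_refl.
by rewrite mulSn; apply: walk_cat (h _ _ exy) IH.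
Qed.

Lemma walk_mono (V : Type) (e e' : V -> V -> Prop) (n : nat) (u v : V) :
  (forall x y, e x y -> e' x y) -> walk e n u v -> walk e' n u v.
Proof.
move=> h W; rewrite -[n]muln1; apply: (walk_map (f := id)) W => x y exy.
exact: walk1 (h _ _ exy).
Qed.

(* Shorten the chain so as to visit each of the [K] sets at most once. *)
Lemma walk_chain (V : Type) (e c : V -> V -> Prop) (M s K : nat)
    (Q : 'I_K -> V -> Prop) (I : V -> Prop) :
    (forall u v, c u v -> walk e s u v) ->
    (forall u v, c u v -> I u -> I v) ->
    (forall u, I u -> exists i, Q i u) ->
    (forall i u v, Q i u -> Q i v -> walk e M u v) ->
  forall n u v, I u -> walk c n u v -> walk e (M + K * (s + M)) u v.
Proof.
move=> cs cI IQ QM n u v Iu W.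
pose r := [rel i j : 'I_K |
  `[< exists x y, [/\ Q i x, Q j y & walk e s x y] >]].
have [i Qi] := IQ u Iu.
have [j Qj ij] : exists2 j, Q j v & connect r i j.
  elim: W Iu i Qi => [k w Iw i Qi|k x y z cxy _ IH Ix i Qi]; first by exists i.
  have Iy := cI _ _ cxy Ix; have [i' Qi'] := IQ y Iy.
  have [j Qj i'j] := IH Iy i' Qi'; exists j => //.
  apply: connect_trans (connect1 _) i'j; apply/asboolP.
  by exists x, y; split=> //; apply: cs.
have lift p : forall i u, path r i p -> Q i u -> Q (last i p) v ->
    walk e (M + size p * (s + M)) u v.
  elim: p => [|j' p IHp] i' u' /=; first by rewrite addn0 => _; apply: QM.
  case/andP=> /asboolP[x [y [Qx Qy xy]]] pp Qu Qv.
  rewrite mulSn; apply: walk_cat (QM _ _ _ Qu Qx) _.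
  by rewrite -addnA; apply: walk_cat xy _; apply: IHp Qy Qv.
case/connectP: ij => p0 pp0 jE; subst j.
case: (shortenP pp0) Qj => p' pp' up' _ Qj.
apply: walk_le (lift _ _ _ pp' Qi Qj).
rewrite leq_add2l leq_mul2r; apply/orP; right.
have := max_card (mem (i :: p')); rewrite (card_uniqP up') card_ord /=.
exact: ltnW.
Qed.

(** A vertex may lie in no bag, so deleting vertices in the induction only shrinks the bags over the
    same [V]. *)
Record linear_bags (V : Type) (e : V -> V -> Prop) (B : nat -> V -> Prop) :
  Prop := LinearBags {
    bag_edge : forall u v, e u v -> exists x, B x u /\ B x v;
    bag_convex : forall v x y z, x <= y <= z -> B x v -> B z v -> B y v }.

(** Follow the walk until an edge has a common bag beyond [y]: by convexity its first end lies in
    bag [y]. *)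
Lemma walk_meets_bag (V : Type) (e : V -> V -> Prop) (B : nat -> V -> Prop)
    (n x y z : nat) (u v : V) :
    linear_bags e B -> x <= y <= z -> B x u -> B z v -> walk e n u v ->
  exists w, [/\ B y w, walk e n u w & walk e n w v].
Proof.
move=> [edge conv] /andP[xy yz] Bu Bv W; elim: W x xy Bu Bv.
  move=> k w x xy Bx Bz; exists w; split; [|exact: walk_refl..].
  by apply: conv Bx Bz; rewrite xy.
move=> k {}u w {}v euw Wwv IH x xy Bu Bv.
have [t [Btu Btw]] := edge _ _ euw.
case: (leqP t y) => [ty|yt].
  have [w' [Bw' W1 W2]] := IH t ty Btw Bv; exists w'; split=> //.
    exact: walk_step euw W1.
  exact: walk_le W2.
exists u; split; [|exact: walk_refl|exact: walk_step euw Wwv].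
by apply: conv Bu Btu; rewrite xy ltnW.
Qed.

(** * Two-colourings with bounded components *)

(** The sets [Q i] may overlap or stick out of [X], so a cover of a bag also covers its subsets. *)
Definition clique_cover (V : Type) (e : V -> V -> Prop) (k : nat)
    (X : V -> Prop) : Prop :=
  exists Q : 'I_k -> V -> Prop,
    (forall v, X v -> exists i, Q i v) /\
    (forall i u v, X u -> X v -> Q i u -> Q i v -> u = v \/ e u v).

Section Breakpoints.
Variables (V : Type) (e : V -> V -> Prop) (B : nat -> V -> Prop) (rho : nat).

(* The last breakpoint up to [x], where a new breakpoint is set as soon as the
   bag is at distance more than [rho] from the bag at the last one. *)
Fixpoint brk (x : nat) : nat :=
  if x is y.+1 then
    if `[< exists u v, [/\ B (brk y) u, B x v & walk e rho u v] >] then brk y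
    else x
  else 0.

Lemma brk_leq x : brk x <= x.
Proof. by elim: x => //= x IH; case: ifP => // _; apply: leqW. Qed.

Lemma brk_mono : {homo brk : x y / x <= y}.
Proof.
move=> x y; elim: y => [|y IH]; first by rewrite leqn0 => /eqP->.
rewrite leq_eqVlt => /predU1P[->//|]; rewrite ltnS => /IH le_xy.
apply: leq_trans le_xy _ => /=; case: ifP => // _.
exact: leqW (brk_leq y).
Qed.

Lemma brk_idem x : brk (brk x) = brk x.
Proof.
by elim: x => //= x IH; case: ifP => // h; rewrite /= h.
Qed.

Lemma brk_close x : brk x <> x ->
  exists u v, [/\ B (brk x) u, B x v & walk e rho u v].
Proof. by case: x => //= x; case: asboolP. Qed.

Hypothesis lin : linear_bags e B.

(** The breakpoint preceding [z] lies between [y] and [z]. A short walk would cross its bag and show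
    that bag [z] is within [rho] of it, so [z] would not be a breakpoint. *)
Lemma brk_far y z u v : brk y = y -> brk z = z -> y < z ->
  B y u -> B z v -> ~ walk e rho u v.
Proof.
move=> yE; case: z => // z zE; rewrite ltnS => yz Bu Bv W.
have le1 : y <= brk z <= z.+1.
  by rewrite -{1}yE brk_mono //= leqW // brk_leq.
have [w [Bw _ W']] := walk_meets_bag lin le1 Bu Bv W.
move: zE => /=; case: asboolP => [_ zE|h _].
  by have := brk_leq z; rewrite zE ltnn.
by apply: h; exists w, v.
Qed.

End Breakpoints.

(** * Colouring the absorbed vertices and merging with a colouring of the rest *)

Section InductionStep.
Variables (V : Type) (e : V -> V -> Prop) (B : nat -> V -> Prop).
Variables (K s : nat).
Hypothesis esym : forall u v, e u v -> e v u.
Hypothesis lin : linear_bags e B.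
Hypothesis cover : forall x, clique_cover e K (B x).

(** If vertices within [s] of two breakpoint bags are within [s] of each other, the bags are within
    [3s], which [brk_far] excludes. *)
Let rho := s + s + s.
Notation brk := (brk e B rho).

Definition near_break v : Prop :=
  exists y, brk y = y /\ exists2 u, B y u & walk e s u v.

(** A bag is within [rho] of the bag at its last breakpoint; one more step reaches a whole clique of
    it. *)
Definition near_last_break v : Prop :=
  exists2 t, B t v & exists2 u, B (brk t) u & walk e rho.+1 u v.

Definition absorbed v : Prop := near_break v \/ near_last_break v.

(** The breakpoint [y] accounts for the colour of [v]; it is the invariant that keeps a chain of one
    colour near one bag. *)
Definition belongs y v : Prop :=
  (near_break v /\ (brk y = y /\ exists2 u, B y u & walk e s u v)) \/
  (~ near_break v /\
   exists t, [/\ B t v, brk t = y & exists2 u, B y u & walk e rho.+1 u v]).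

Lemma absorbed_belongs v : absorbed v -> exists y, belongs y v.
Proof.
move=> Ev; case: (pselect (near_break v)) => [Av|nAv].
  by have [y Hy] := Av; exists y; left.
case: Ev => // -[t Bt Hu]; exists (brk t); right; split=> //.
by exists t.
Qed.

Lemma belongs_near y v : belongs y v -> exists2 u, B y u & walk e rho.+1 u v.
Proof.
case=> [[_ [_ [u Bu W]]]|[_ [t [_ _ //]]]]; exists u => //.
by apply: walk_le W; rewrite /rho; lia.
Qed.

(* Between two bags with different last breakpoints lies a breakpoint bag. *)
Lemma walk_cross_break n u v t t' : n <= s -> B t u -> B t' v ->
  walk e n u v -> brk t < brk t' -> near_break v.
Proof.
move=> ns Bt Bt' W lt; exists (brk t'); split; first exact: brk_idem.
have tt' : t <= brk t' <= t'.
  rewrite brk_leq andbT ltnW // ltnNge; apply/negP => h.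
  by have := brk_mono e B rho h; rewrite brk_idem leqNgt lt.
have [w [Bw _ W']] := walk_meets_bag lin tt' Bt Bt' W.
by exists w => //; apply: walk_le W'.
Qed.

Definition chained u v : Prop :=
  [/\ absorbed u, absorbed v, near_break u <-> near_break v & walk e s u v].

(** Red vertices near distinct breakpoints would contradict [brk_far]. Blue ones with distinct last
    breakpoints would have a breakpoint bag between them, making one of them red. *)
Lemma chained_belongs y u v : chained u v -> belongs y u -> belongs y v.
Proof.
case=> Eu Ev Auv W [[Au [yE [w Bw Wu]]]|[nAu [t [Btu tE _]]]].
  have Av := Auv.1 Au; have [z [zE [w' Bw' Wv]]] := Av.
  have far : walk e rho w w'.
    by apply: walk_cat (walk_cat Wu W) (walk_sym esym Wv).
  left; split=> //; suff -> : y = z by split=> //; exists w'.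
  case: (ltngtP y z) => // h; first by case: (brk_far lin yE zE h Bw Bw' far).
  by case: (brk_far lin zE yE h Bw' Bw (walk_sym esym far)).
have nAv : ~ near_break v by move/Auv.2.
right; split=> //; case: Ev => // -[t' Btv Hv].
suff tt' : brk t' = brk t by exists t'; rewrite -tE -tt'.
case: (ltngtP (brk t') (brk t)) => // h; [case: nAu|case: nAv].
  exact: walk_cross_break (leqnn s) Btv Btu (walk_sym esym W) h.
exact: walk_cross_break (leqnn s) Btu Btv W h.
Qed.

(** [M] bounds the distance between vertices near the same clique: to the clique, across it and
    back. The rest of the sum is the cost of passing through [K] cliques in [walk_chain]. *)
Definition absorbed_bound : nat :=
  let M := rho.+1 + 1 + rho.+1 in M + K * (s + M).

Lemma absorbed_chain n u v : absorbed u -> walk chained n u v ->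
  walk e absorbed_bound u v.
Proof.
move=> /absorbed_belongs[y yu]; have [Q [Qcov Qcl]] := cover y.
pose Q' i v := exists w, [/\ B y w, Q i w & walk e rho.+1 w v].
apply: (walk_chain (Q := Q') (I := belongs y)) => //.
- by move=> a b [].
- by move=> a b; apply: chained_belongs.
- move=> a /belongs_near[w Bw W]; have [i Qi] := Qcov w Bw.
  by exists i, w.
- move=> i a b [w [Bw Qw W]] [w' [Bw' Qw' W']].
  apply: walk_cat W'; apply: walk_cat (walk_sym esym W) _.
  case: (Qcl _ _ _ Bw Bw' Qw Qw') => [->|]; first exact: walk_refl.
  exact: walk1.
Qed.

Definition rest_adj u v : Prop := [/\ e u v, ~ absorbed u & ~ absorbed v].
Definition rest_bag x v : Prop := B x v /\ ~ absorbed v.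

Lemma rest_linear : linear_bags rest_adj rest_bag.
Proof.
split=> [u v [euv nu nv]|v x y z xyz [Bx nv] [Bz _]].
  by have [x [Bu Bv]] := bag_edge lin euv; exists x.
by split=> //; apply: bag_convex lin _ _ _ _ xyz Bx Bz.
Qed.

Lemma near_break_bag y v : brk y = y -> B y v -> near_break v.
Proof.
by move=> yE Bv; exists y; split=> //; exists v => //; apply: walk_refl.
Qed.

Lemma rest_cover k x :
  clique_cover e k.+1 (B x) -> clique_cover rest_adj k (rest_bag x).
Proof.
move=> [Q [Qcov Qcl]].
case: (pselect (brk x = x)) => [xE|/brk_close[u [w [Bu Bw W]]]].
  (* A breakpoint bag is absorbed entirely, so any family covers what is left. *)
  exists (fun _ _ => True); split=> [v [Bv nv]|i v ? [Bv nv]]; case: nv; left.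
    exact: near_break_bag xE Bv.
  exact: near_break_bag xE Bv.
(* The clique of [w] is within [rho.+1] of the last breakpoint bag, hence absorbed; [lift i0] lists
   the other [k] cliques. *)
have [i0 Qi0] := Qcov w Bw.
exists (fun i v => Q (lift i0 i) v).
split=> [v [Bv nv]|i v v' [Bv nv] [Bv' nv'] Qv Qv'].
  have [i Qi] := Qcov v Bv; case: (unliftP i0 i) Qi => [j ->|->] Qi.
    by exists j.
  case: nv; right; exists x => //; exists u => //.
  rewrite -addn1; apply: walk_cat W _.
  case: (Qcl _ _ _ Bw Bv Qi0 Qi) => [->|]; first exact: walk_refl.
  exact: walk1.
by case: (Qcl _ _ _ Bv Bv' Qv Qv') => [->|evv']; [left|right].
Qed.

Variables (R : nat) (c : V -> bool).
(** A detour through the rest costs one step in, at most [R] inside and one step out. *)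
Hypothesis sR : R.+2 <= s.
Let rest_mono u v := rest_adj u v /\ c u = c v.
Hypothesis cR : forall n u v, walk rest_mono n u v -> walk e R u v.

Definition merged v : bool :=
  if `[< absorbed v >] then `[< near_break v >] else c v.

Lemma mergedE v : absorbed v -> merged v = `[< near_break v >].
Proof. by rewrite /merged; case: asboolP. Qed.

Lemma merged_rest v : ~ absorbed v -> merged v = c v.
Proof. by rewrite /merged; case: asboolP. Qed.

Lemma merged_chained u v : absorbed u -> absorbed v -> merged u = merged v ->
  walk e s u v -> chained u v.
Proof.
move=> Eu Ev; rewrite !mergedE // => h W; split=> //.
by split=> /asboolP H; apply/asboolP; move: h H => ->.
Qed.

Let mono u v := e u v /\ merged u = merged v.

(* Between consecutive visits to the absorbed vertices a monochromatic walk
   stays in a monochromatic component of the rest, so these visits are at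
   distance at most [s] and form a chain. *)
Lemma merged_walk n u v : walk mono n u v ->
  (exists m, walk rest_mono m u v) \/
  exists a b m m' w,
    [/\ absorbed a, merged u = merged a,
        walk rest_mono m' u w /\ (w = a \/ mono w a),
        walk chained m a b & walk e R.+1 b v].
Proof.
(* Here [a] and [b] will be the first and last absorbed vertices of the walk, and [w] the vertex
   before [a], or [a] itself if the walk starts there. *)
have reach u' a m' w : walk rest_mono m' u' w -> w = a \/ mono w a ->
    walk e R.+1 u' a.
  move=> W1 W2; rewrite -addn1; apply: walk_cat (cR W1) _.
  case: W2 => [->|[ewa _]]; first exact: walk_refl.
  exact: walk1.
elim=> [k w|k u' x y [eu cu] _ IH]; first by left; exists 0; apply: walk_refl.
have [Eu'|nEu'] := pselect (absorbed u').
  right; case: IH => [[m W]|[a [b [m [m' [w [Ea ca [W1 W2] Wab Wb]]]]]]].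
    exists u', u', 0, 0, u'; split=> //; [|exact: walk_refl|].
      by split; [apply: walk_refl|left].
    exact: walk_step eu (cR W).
  exists u', b, m.+1, 0, u'; split=> //.
    by split; [apply: walk_refl|left].
  apply: walk_step Wab; apply: merged_chained => //; first by rewrite cu.
  by apply: walk_le sR _; apply: walk_step eu (reach _ _ _ _ W1 W2).
have [Ex|nEx] := pselect (absorbed x).
  right; case: IH => [[m W]|[a [b [m [m' [w [Ea ca [W1 W2] Wab Wb]]]]]]].
    exists x, x, 0, 0, u'; split=> //; [|exact: walk_refl|].
      by split; [apply: walk_refl|right].
    exact: walk_le (leqnSn _) (cR W).
  exists x, b, m.+1, 0, u'; split=> //.
    by split; [apply: walk_refl|right].
  apply: walk_step Wab; apply: merged_chained => //.
  by apply: walk_le (reach _ _ _ _ W1 W2); apply: ltnW.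
have step : rest_mono u' x by split=> //; rewrite -!merged_rest.
case: IH => [[m W]|[a [b [m [m' [w [Ea ca [W1 W2] Wab Wb]]]]]]].
  by left; exists m.+1; apply: walk_step step W.
right; exists a, b, m, m'.+1, w; split=> //; first by rewrite cu.
by split=> //; apply: walk_step step W1.
Qed.

Lemma merged_bounded n u v :
  walk mono n u v -> walk e (R.+1 + absorbed_bound + R.+1) u v.
Proof.
case/merged_walk => [[m W]|[a [b [m [m' [w [Ea _ [W1 W2] Wab Wb]]]]]]].
  by apply: walk_le (cR W); lia.
apply: walk_cat Wb; apply: walk_cat (absorbed_chain Ea Wab).
rewrite -addn1; apply: walk_cat (cR W1) _.
by case: W2 => [->|[ewa _]]; [apply: walk_refl|apply: walk1].
Qed.

End InductionStep.

Definition two_colourable (k D : nat) : Prop :=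
  forall (V : Type) (e : V -> V -> Prop) (B : nat -> V -> Prop),
    (forall u v, e u v -> e v u) -> linear_bags e B ->
    (forall x, clique_cover e k (B x)) ->
  exists c : V -> bool,
    forall n u v, walk (fun a b => e a b /\ c a = c b) n u v -> walk e D u v.

Lemma bounded_two_colouring k : exists D, two_colourable k D.
Proof.
elim: k => [|k [R IH]].
  (* Without cliques the bags are empty, so there is no edge. *)
  exists 0 => V e B _ lin cover; exists xpredT => n u v [m w|m a b w [eab _] _].
    exact: walk_refl.
  have [x [Bx _]] := bag_edge lin eab.
  by have [Q [/(_ _ Bx)[[]]]] := cover x.
exists (R.+1 + absorbed_bound k.+1 R.+2 + R.+1) => V e B esym lin cover.
have [||c cR] :=
  IH V (rest_adj e B R.+2) (rest_bag e B R.+2) _ (rest_linear _ lin).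
- by move=> u v [euv nu nv]; split=> //; apply: esym.
- by move=> x; apply: rest_cover; apply: cover.
exists (merged e B R.+2 c) => n u v.
apply: merged_bounded => // {}n {}u {}v W.
by apply: walk_mono (cR _ _ _ W) => x y [].
Qed.

(** * Distances, quasi-isometries and path-decompositions *)

Definition gwalk (G : sgraph) : nat -> G -> G -> Prop :=
  walk (fun u v : G => adj u v).

Lemma adjC (G : sgraph) (u v : G) : adj u v -> adj v u.
Proof. by rewrite adj_sym. Qed.

Lemma gwalkC (G : sgraph) n (u v : G) : gwalk n u v -> gwalk n v u.
Proof. by apply: walk_sym => x y; apply: adjC. Qed.

Section Dist.
Variable G : sgraph.
Implicit Types u v : G.

Lemma gwalk_path n u v : gwalk n u v <->
  exists p, [/\ path (@adj G) u p, last u p = v & size p <= n].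
Proof.
split=> [|[p [pp <- sp]]].
  elim=> [k w|k x y z xy _ [p [pp lp sp]]]; first by exists [::].
  by exists (y :: p); split=> //=; rewrite xy.
apply: walk_le sp _; elim: p u pp => [|w p IH] u /=.
  by move=> _; apply: walk_refl.
by case/andP=> uw /IH; apply: walk_step.
Qed.

Lemma has_path_gwalk n u v : has_path u v n -> gwalk n u v.
Proof.
case/existsP=> p /and3P[pp _ /eqP lp]; apply/gwalk_path.
by exists (val p); split=> //; rewrite size_tuple.
Qed.

(** Removing repetitions leaves fewer than [#|G|] edges, within the range of the minimum in
    [dist]. *)
Lemma gwalk_has_path n u v : gwalk n u v ->
  exists2 m : 'I_#|{: G}|, m <= n & has_path u v m.
Proof.
case/gwalk_path=> p [pp lp sp]; case: (shortenP pp) lp => p' pp' up' sub lp.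
have sz : size p' < #|{: G}|.
  by have := max_card (mem (u :: p')); rewrite (card_uniqP up').
exists (Ordinal sz) => /=.
  apply: leq_trans sp; apply: uniq_leq_size sub.
  by case/andP: up'.
by apply/existsP; exists (in_tuple p'); rewrite pp' lp eqxx up'.
Qed.

Lemma dist_leP n u v : (dist u v <= n%:R%:E)%E <-> gwalk n u v.
Proof.
rewrite /dist; split=> [/bigmin_leP[//|[m mp]]|/gwalk_has_path[m mn mp]].
  rewrite lee_fin ler_nat => mn.
  exact: walk_le mn (has_path_gwalk mp).
apply/bigmin_leP; right; exists m => //.
by rewrite lee_fin ler_nat.
Qed.

Lemma dist_cases u v :
  dist u v = +oo%E \/ exists2 m, dist u v = m%:R%:E & gwalk m u v.
Proof.
suff: dist u v = +oo%E \/ exists m, dist u v = m%:R%:E.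
  case=> [->|[m dE]]; [by left|right; exists m => //].
  by apply/dist_leP; rewrite dE.
rewrite /dist; elim/big_ind: _ => [|x y hx hy|i _]; first by left.
  by rewrite /Order.min; case: ifP.
by right; exists i.
Qed.

Lemma weak_diameterP (X : {set G}) n :
  (weak_diameter X <= n%:R%:E)%E <-> {in X &, forall u v, gwalk n u v}.
Proof.
rewrite /weak_diameter; split=> [/bigmax_leP[_ h] u v uX vX|h].
  by have /bigmax_leP[_ h'] := h u uX; apply/dist_leP/h'.
apply/bigmax_leP; split=> [|u uX]; first by rewrite lee_fin ler0n.
apply/bigmax_leP; split=> [|v vX]; first by rewrite lee_fin ler0n.
exact/dist_leP/h.
Qed.

End Dist.

(** Multiplying the lower bound by [q] clears the inverse; an infinite distance means that no walk
    exists. *)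
Lemma quasi_isometryP (q : nat) (G H : sgraph) (phi : G -> H) : 0 < q ->
  quasi_isometry q phi <->
  [/\ forall n u v, gwalk n u v -> gwalk (q * n + q) (phi u) (phi v),
      forall n u v, gwalk n (phi u) (phi v) -> gwalk (q * (n + q)) u v
    & forall x, exists v, gwalk q x (phi v)].
Proof.
move=> q0; have q0r : (0 < q%:R :> rat)%R by rewrite ltr0n.
have lowerE m n : ((q%:R^-1)%:E * m%:R%:E - q%:R%:E <= (n%:R : rat)%:E)%E =
                  (m <= q * (n + q)).
  rewrite -EFinM -EFinB lee_fin lerBlDr ler_pdivrMl //.
  by rewrite -natrD -natrM ler_nat.
have upperE m : ((q%:R : rat)%:E * m%:R%:E + q%:R%:E)%E = (q * m + q)%:R%:E.
  by rewrite -EFinM -EFinD -natrM -natrD.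
split=> [[dphi sphi]|[up low surj]].
  split=> [n u v W|n u v W|x].
  - have [_] := dphi u v; have /dist_leP := W.
    case: (dist_cases u v) => [->|[m -> _]]; first by rewrite leye_eq.
    rewrite lee_fin ler_nat upperE => mn /dist_leP; apply: walk_le.
    by rewrite leq_add2r leq_mul2l mn orbT.
  - have [+ _] := dphi u v; have /dist_leP := W.
    case: (dist_cases u v) => [->|[m -> Wm]] Wn.
      rewrite gt0_muley ?lte_fin ?invr_gt0 // => /le_trans/(_ Wn).
      by rewrite /= leye_eq.
    by move=> /le_trans/(_ Wn); rewrite lowerE => h; apply: walk_le h Wm.
  - by have [v /dist_leP] := sphi x; exists v.
split=> [u v|x]; last by have [v /dist_leP] := surj x; exists v.
split.
  case: (dist_cases (phi u) (phi v)) => [->|[n -> Wn]]; first exact: leey.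
  have /dist_leP := low _ _ _ Wn.
  case: (dist_cases u v) => [->|[m -> Wm]]; first by rewrite leye_eq.
  by rewrite lee_fin ler_nat lowerE.
case: (dist_cases u v) => [->|[n -> Wn]].
  by rewrite gt0_muley ?lte_fin //= leey.
by rewrite upperE; apply/dist_leP/up.
Qed.

Lemma path_connectedP n (X : {set path_graph n}) : induces_connected X <->
  forall x y z : 'I_n.+1, x <= y <= z -> x \in X -> z \in X -> y \in X.
Proof.
split=> [conn x y z /andP[xy yz] xX zX|conv x y xX yX].
  have /connectP[p pp zE] := conn x z xX zX.
  elim: p x xX xy pp zE => [|w p IH] x xX xy /=.
    move=> _ zE; suff -> : y = x by [].
    by apply: val_inj; move: yz; rewrite zE /=; lia.
  case/andP=> /and3P[_ wX]; rewrite /path_rel => xw pp zE.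
  case: (leqP w y) => wy; first exact: (IH w).
  by suff -> : y = x by []; apply: val_inj; rewrite /=; lia.
have up m : forall x y : 'I_n.+1, y = x + m :> nat -> x \in X -> y \in X ->
    connect [rel a b | [&& a \in X, b \in X & adj a b]] x y.
  elim: m => [|m IH] a b ab aX bX.
    by have -> : b = a by apply: val_inj; rewrite /= ab addn0.
  have lt : x + 0 < n.+1 by rewrite addn0.
  have a1 : a.+1 < n.+1 by have := ltn_ord b; rewrite ab; lia.
  have cX : Ordinal a1 \in X by apply: conv aX bX; rewrite /= ab; lia.
  apply: connect_trans (connect1 _) (IH (Ordinal a1) b _ cX bX); last first.
    by rewrite /= ab; lia.
  by rewrite /= aX cX /= /path_rel /= eqxx.
case/orP: (leq_total x y) => xy; first by apply: (up (y - x)) => //; lia.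
have csym :
    symmetric [rel a b : path_graph n | [&& a \in X, b \in X & adj a b]].
  by move=> a b /=; rewrite path_rel_sym andbCA.
by rewrite (sym_connect_sym csym); apply: (up (x - y)) => //; lia.
Qed.

(** The bags are continued by empty ones beyond the last node. *)
Definition nat_bag (G : sgraph) n (beta : path_graph n -> {set G})
    (x : nat) (v : G) : Prop := exists2 i : 'I_n.+1, x = i & v \in beta i.

(** The relation [e] is arbitrary, to allow for [adj], its extension by cliques and the
    monochromatic part of the latter. *)
Lemma path_decomposition_linear (G : sgraph) n (beta : path_graph n -> {set G})
    (e : G -> G -> Prop) :
    path_decomposition beta ->
    (forall u v, e u v -> exists i : 'I_n.+1, u \in beta i /\ v \in beta i) ->
  linear_bags e (nat_bag beta).
Proof.
move=> [_ conn] edge; split=> [u v /edge[i [iu iv]]|v x y z xyz].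
  by exists (i : nat); split; exists i.
case=> i xi iv [j zj jv]; have y_n : y < n.+1.
  by have := ltn_ord j; lia.
exists (Ordinal y_n) => //; have [_ /path_connectedP h] := conn v.
have := h i (Ordinal y_n) j; rewrite !inE; apply=> //.
by rewrite /= -xi -zj.
Qed.

Lemma linear_path_decomposition (G : sgraph) n
    (beta : path_graph n -> {set G}) :
    linear_bags (fun u v => adj u v) (nat_bag beta) ->
    (forall v, exists x, v \in beta x) ->
  path_decomposition beta.
Proof.
move=> [edge conv] cov.
split=> [u v /edge[_ [[i -> iu] [j /val_inj<- iv]]]|v X].
  by exists i.
split; first by have [x vx] := cov v; apply/set0Pn; exists x; rewrite inE.
apply/path_connectedP => x y z xyz; rewrite !inE => vx vz.
have [||i /val_inj-> //] := conv v _ _ _ xyz; first by exists x.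
by exists z.
Qed.

Lemma pathwidth_leP (G : sgraph) k : (pathwidth G <= k%:Z - 1)%R <->
  exists n, exists2 beta : path_graph n -> {set G},
    path_decomposition beta & forall x, #|beta x| <= k.
Proof.
rewrite /pathwidth lerD2r lez_nat.
case: ex_minnP => m /asboolP[n [beta pd wE]] mmin.
split=> [mk|[n' [beta' pd' wk]]].
  exists n, beta => // x; apply: leq_trans mk.
  move/eqP: wE; rewrite /width (inj_eq (addIr _)) eqz_nat => /eqP <-.
  exact: leq_bigmax.
apply: leq_trans (mmin (\max_x #|beta' x|) _) _; last by apply/bigmax_leqP.
by apply/asboolP; exists n', beta'.
Qed.

(** * The two directions *)

(** Vertices mapped within [c] of the same [w] have images within [2c], hence are within
    [c * (2c + c)]; a bag of [H] offers at most [k + 1] choices of [w]. *)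
Lemma quasi_isometric_centred (c k : nat) (G H : sgraph) (phi : G -> H) :
    0 < c -> quasi_isometry c phi -> (pathwidth H <= k%:Z)%R ->
  has_centred_path_decomposition k.+1 (3 * c ^ 2) G.
Proof.
move=> c0 /(quasi_isometryP _ c0)[up low _].
have -> : (k%:Z = k.+1%:Z - 1)%R by rewrite -addn1 PoszD addrK.
case/pathwidth_leP => n [beta pd wk].
pose B i : {set G} :=
  [set v | `[< exists2 w, w \in beta i & gwalk c w (phi v) >]].
have inB i v : v \in B i <-> exists2 w, w \in beta i & gwalk c w (phi v).
  by rewrite inE; split=> /asboolP.
have linH : linear_bags (fun u v : H => adj u v) (nat_bag beta).
  by apply: (path_decomposition_linear pd); case: pd.
have covH w : exists x, w \in beta x.
  by have [_ /(_ w)[/set0Pn[x]]] := pd; rewrite inE; exists x.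
exists n, B.
  apply: linear_path_decomposition => [|v]; last first.
    have [x wx] := covH (phi v); exists x; apply/inB; exists (phi v) => //.
    exact: walk_refl.
  split=> [u v uv|v x y z xyz].
    (* The images of adjacent vertices are within [c + c], so a midpoint [w] is within [c] of
       both. *)
    have [w [Wu Wv]] := walk_split (up _ _ _ (walk1 uv)).
    rewrite muln1 in Wu; have [x wx] := covH w.
    by exists (x : nat); split; exists x => //; apply/inB; exists w => //;
      apply: gwalkC.
  case=> i xi /inB[w1 w1i W1] [j zj /inB[w2 w2j W2]].
  (* Bag [y] separates [t] from [x] or from [z], so it meets a walk of length [c] ending or starting
     at [phi v]. *)
  have [t vt] := covH (phi v).
  have Bt : nat_bag beta t (phi v) by exists t.
  have [w [[l yl wl] Ww]] : exists w, nat_bag beta y w /\ gwalk c w (phi v).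
    case: (leqP y t) => yt.
      have B1 : nat_bag beta x w1 by exists i.
      have xyt : x <= y <= t by lia.
      by have [w [Bw _ W]] := walk_meets_bag linH xyt B1 Bt W1; exists w.
    have B2 : nat_bag beta z w2 by exists j.
    have tyz : t <= y <= z by lia.
    have [w [Bw W _]] := walk_meets_bag linH tyz Bt B2 (gwalkC W2).
    by exists w; split=> //; apply: gwalkC.
  by exists l => //; apply/inB; exists w.
(* Group the vertices of the bag by a chosen nearby vertex of [beta x]. *)
move=> x; pose g v := [pick w in beta x | `[< gwalk c w (phi v) >]].
exists (preim_partition g (B x)); split=> [||X].
- exact: preim_partitionP.
- have gS v : v \in B x -> g v \in Some @: beta x.
    case/inB=> w wx W; rewrite /g; case: pickP => [w' /andP[w'x _]|/(_ w)].
      exact: imset_f.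
    by rewrite /= wx /=; case: asboolP.
  apply: leq_trans (wk x); apply: leq_trans (leq_imset_card Some _).
  apply: leq_trans (subset_leq_card _)
    (leq_imset_card (fun w => [set v in B x | w == g v]) _).
  apply/subsetP=> _ /imsetP[v vB ->]; apply/imsetP; exists (g v) => //.
  exact: gS.
- case/imsetP=> v vB ->; apply/weak_diameterP => a b; rewrite !inE.
  case/andP=> aB /eqP ga /andP[bB /eqP gb].
  have gab : g a = g b by rewrite -ga.
  move: aB gab => /asboolP[w wx Ww]; rewrite /g.
  case: pickP => [w1 /andP[_ /asboolP W1]|/(_ w)]; last first.
    by rewrite /= wx /=; case: asboolP.
  case: pickP => // w2 /andP[_ /asboolP W2] [w12]; subst w2.
  have := low _ _ _ (walk_cat (gwalkC W1) W2); apply: walk_le.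
  by rewrite expnS expn1; lia.
Qed.

(** * Contracting the components of a relation *)

Section Quotient.
Variables (G : sgraph) (r : rel G).

Definition quotient_vert := {x : G | roots r x}.

Hypothesis rsym : connect_sym r.

Definition quotient_map (v : G) : quotient_vert :=
  exist _ (fingraph.root r v) (roots_root rsym v).

Definition quotient_adj : rel quotient_vert := fun a b =>
  (a != b) && [exists u, exists v,
    [&& quotient_map u == a, quotient_map v == b & adj u v]].

Lemma quotient_adj_sym : symmetric quotient_adj.
Proof.
suff h a b : quotient_adj a b -> quotient_adj b a.
  by move=> a b; apply/idP/idP; apply: h.
case/andP=> ab /existsP[u /existsP[v /and3P[ua vb uv]]].
rewrite /quotient_adj eq_sym ab; apply/existsP; exists v.
by apply/existsP; exists u; rewrite ua vb adj_sym.
Qed.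

Lemma quotient_adj_irrefl : irreflexive quotient_adj.
Proof. by move=> a; rewrite /quotient_adj eqxx. Qed.

Definition quotient : sgraph := SGraph quotient_adj_sym quotient_adj_irrefl.

Lemma quotient_mapP u v : quotient_map u = quotient_map v <-> connect r u v.
Proof.
split=> [[ruv]|/(fingraph.rootP rsym) ruv]; first exact/(fingraph.rootP rsym).
exact: val_inj.
Qed.

Lemma quotient_mapK (a : quotient_vert) : quotient_map (val a) = a.
Proof. by apply: val_inj; apply/eqP; apply: (valP a). Qed.

(** Contraction lengthens no walk. Conversely, each edge of a quotient walk lifts to an edge, and
    connecting the lifts costs [D] in each component visited. *)
Lemma quotient_quasi_isometry D :
    (forall u v, connect r u v -> gwalk D u v) ->
  quasi_isometry D.+1 (quotient_map : G -> quotient).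
Proof.
move=> rD; apply/quasi_isometryP => //; split=> [n u v W|n u v W|a].
- suff: gwalk (n * 1) (quotient_map u : quotient) (quotient_map v).
    by apply: walk_le; lia.
  apply: walk_map W => x y xy.
  have [->|nxy] := eqVneq (quotient_map x) (quotient_map y).
    exact: walk_refl.
  apply: walk1; rewrite /= /quotient_adj nxy; apply/existsP; exists x.
  by apply/existsP; exists y; rewrite !eqxx.
- suff h m (a b : quotient) : gwalk m a b -> forall u v,
      quotient_map u = a -> quotient_map v = b -> gwalk (m * D.+1 + D) u v.
    by have := h _ _ _ W _ _ erefl erefl; apply: walk_le; lia.
  elim=> [k w u' v' uw vw|k x y z xy _ IH u' v' ux vz].
    by apply: walk_le (rD u' v' _); [lia|apply/quotient_mapP; rewrite uw vw].
  case/andP: xy => _ /existsP[u1 /existsP[v1 /and3P[/eqP u1x /eqP v1y uv1]]].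
  have W1 : gwalk D u' u1 by apply: rD; apply/quotient_mapP; rewrite ux.
  have := walk_cat (walk_cat W1 (walk1 uv1)) (IH v1 v' v1y vz).
  by apply: walk_le; lia.
- by exists (val a); rewrite quotient_mapK; apply: walk_refl.
Qed.

End Quotient.

Lemma centred_quasi_isometric (k d D : nat) (G : sgraph) :
    0 < d -> two_colourable k D ->
    has_centred_path_decomposition k d G ->
  exists H : sgraph, quasi_isometric (D * d).+1 G H /\
    (pathwidth H <= (2 * k)%:Z - 1)%R.
Proof.
move=> d0 colour [n [beta pd /choice[P cP]]].
pose e u v := adj u v \/ exists x, exists2 X, X \in P x & u \in X /\ v \in X.
have esym u v : e u v -> e v u.
  case=> [/adjC|[x [X XP [uX vX]]]]; first by left.
  by right; exists x, X.
have edge u v : e u v -> exists i : 'I_n.+1, u \in beta i /\ v \in beta i.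
  case=> [uv|[x [X XP [uX vX]]]]; first by case: pd => /(_ u v uv).
  have [pP _ _] := cP x; exists x; rewrite -(cover_partition pP).
  by split; apply/bigcupP; exists X.
have ed u v : e u v -> gwalk d u v.
  case=> [uv|[x [X XP [uX vX]]]]; first exact: walk_le d0 (walk1 uv).
  by have [_ _ /(_ X XP)/weak_diameterP] := cP x; apply.
have lin := path_decomposition_linear pd edge.
have [|c cD] := colour G e (nat_bag beta) esym lin.
  (* For [x > n] the value of [inord] is harmless, since [nat_bag beta x] is empty. *)
  move=> x; pose i0 : 'I_n.+1 := inord x; have [pP cardP _] := cP i0.
  exists (fun i v => v \in nth set0 (enum (P i0)) i); split.
    move=> v [i xi vi]; have i0i : i0 = i by rewrite /i0 xi inord_val.
    move: vi; rewrite -i0i -(cover_partition pP) => /bigcupP[X XP vX].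
    have lt : index X (enum (P i0)) < k.
      by apply: leq_trans cardP; rewrite cardE index_mem mem_enum.
    by exists (Ordinal lt); rewrite /= nth_index ?mem_enum.
  move=> i u v _ _ ui vi; right; right; exists i0.
  exists (nth set0 (enum (P i0)) i) => //; rewrite -mem_enum mem_nth // ltnNge.
  by apply/negP => /(nth_default set0) h; move: ui; rewrite h inE.
pose mono a b := e a b /\ c a = c b.
pose r : rel G := [rel a b | `[< mono a b >]].
have rsym : connect_sym r.
  apply: sym_connect_sym => a b /=; apply/asboolP/asboolP => -[eab cab];
    by split=> //; apply: esym.
have rW u v : connect r u v <-> exists m, walk mono m u v.
  split=> [/connectP[p pp ->]|[m]].
    elim: p u pp => [|w p IH] u /=; first by exists 0; apply: walk_refl.
    case/andP=> /asboolP uw /IH[m W]; exists m.+1.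
    exact: walk_step uw W.
  elim=> [? w|? a b w ab _]; first exact: connect0.
  by apply/connect_trans/connect1/asboolP.
have rD u v : connect r u v -> gwalk (D * d) u v.
  by case/rW=> m /cD; apply: (walk_map (f := id)).
exists (quotient rsym); split.
  by exists (quotient_map rsym); apply: quotient_quasi_isometry.
pose phi : G -> quotient rsym := quotient_map rsym.
have phiE u v : phi u = phi v <-> exists m, walk mono m u v.
  by rewrite -rW; apply: quotient_mapP.
apply/pathwidth_leP; exists n, (fun x => phi @: beta x).
  apply: linear_path_decomposition => [|a]; last first.
    have [_ /(_ (val a))[/set0Pn[x]]] := pd; rewrite inE => ax _.
    by exists x; apply/imsetP; exists (val a); rewrite // /phi quotient_mapK.
  split=> [a b|a x y z xyz].
    case/andP=> _ /existsP[u /existsP[v /and3P[/eqP<- /eqP<- uv]]].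
    have [x [ux vx]] := pd.1 u v uv.
    by exists (x : nat); split; exists x; rewrite // imset_f.
  (* A component meeting bags [x] and [z] contains a monochromatic walk between them, which meets
     bag [y]. *)
  case=> i xi /imsetP[u ui ->] [j zj /imsetP[v vj uv]].
  have /phiE[m W] := uv.
  have linm : linear_bags mono (nat_bag beta).
    by apply: (path_decomposition_linear pd) => u' v' [/edge].
  have [w [[l yl wl] W1 _]] := walk_meets_bag linm xyz
    (ex_intro2 _ _ i xi ui) (ex_intro2 _ _ j zj vj) W.
  exists l => //; apply/imsetP; exists w => //.
  by apply/phiE; exists m.
move=> x; have [pP cardP _] := cP x.
pose s (a : quotient rsym) : G := odflt (val a) [pick v in beta x | phi v == a].
have sP a : a \in phi @: beta x -> s a \in beta x /\ phi (s a) = a.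
  case/imsetP=> v vx ->; rewrite /s.
  case: pickP => [w /andP[wx /eqP]|/(_ v)] //.
  by rewrite vx eqxx.
(* Representatives in the same part and of the same colour are joined by a monochromatic edge, so a
   bag meets at most [2 * k] components. *)
pose f a := (pblock (P x) (s a), c (s a)).
have finj : {in phi @: beta x &, injective f}.
  move=> a b /sP[sa ea] /sP[sb eb] [pab cab]; rewrite -ea -eb; apply/phiE.
  exists 1.
  move: sa sb; rewrite -(cover_partition pP) => sa sb.
  apply: walk1; split=> //; right; exists x, (pblock (P x) (s a)).
    exact: pblock_mem.
  by split; rewrite ?mem_pblock // pab mem_pblock.
rewrite -(card_in_imset finj).
have sub : f @: (phi @: beta x) \subset setX (P x) [set: bool].
  apply/subsetP=> _ /imsetP[a /sP[sa _] ->]; rewrite !inE andbT.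
  by apply: pblock_mem; rewrite (cover_partition pP).
apply: leq_trans (subset_leq_card sub) _.
by rewrite cardsX cardsT card_bool mulnC leq_mul2l.
Qed.

Local Open Scope ring_scope.

Theorem theorem2 :
  exists q : nat -> nat -> nat,
    (forall k d : nat, (0 < k)%N -> (0 < d)%N -> (0 < q k d)%N) /\
    forall c d k : nat, (0 < c)%N -> (0 < d)%N -> (0 < k)%N ->
      (forall G : sgraph, has_centred_path_decomposition k d G ->
         exists H : sgraph,
           quasi_isometric (q k d) G H /\ pathwidth H <= (2 * k)%:Z - 1) /\
      (forall G : sgraph,
         (exists H : sgraph, quasi_isometric c G H /\ pathwidth H <= k%:Z) ->
         has_centred_path_decomposition k.+1 (3 * c ^ 2) G).
Proof.
have [D colour] := choice bounded_two_colouring.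
(* Components have weak diameter at most [D k * d] in [G]; the successor comes from
   [quotient_quasi_isometry]. *)
exists (fun k d => (D k * d).+1); split=> // c d k c0 d0 _; split=> [G|G].
  exact: centred_quasi_isometric (colour k).
by case=> H [[phi qi] pw]; apply: quasi_isometric_centred qi pw.
Qed.
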